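(* In the trusted-correlation model, the benign point $p_0=(T_0,\xi_0)$ is the only local minimizer of $D(p):=D(\Sigma_0\Vert\Sigma(p))$ on the matching set $\mathcal F_{\mathcal M}$.
   Context: Constants: $V_A>0$, $\eta\in(0,1]$, $v_{\mathrm{el}}\ge0$. Parameters $p=(T,\xi)\in\mathcal D=[T_{\min},1]\times[0,\xi_{\max}]$ with $0<T_{\min}\le T_0$, $\xi_{\max}<\infty$; benign point $p_0=(T_0,\xi_0)\in\mathcal D$. $$\Sigma(T,\xi)=\begin{pmatrix}V_A&\sqrt{\eta T}\,V_A\\\sqrt{\eta T}\,V_A&\eta TV_A+N(T,\xi)\end{pmatrix},\quad N(T,\xi)=1+v_{\mathrm{el}}+\eta T\xi,\quad \Sigma_0=\Sigma(p_0).$$ $D(\Sigma_0\Vert\Sigma_1)=\tfrac12[\operatorname{tr}(\Sigma_1^{-1}\Sigma_0)-2+\ln(\det\Sigma_1/\det\Sigma_0)]$. In the trusted-correlation model the monitored set $\mathcal M$ consists of the entries $V_A$ and $\sqrt{\eta T}V_A$ of $\Sigma$; the matching set $\mathcal F_{\mathcal M}$ is the set of $p\in\mathcal D$ whose $\Sigma(p)$ agrees with $\Sigma_0$ on these entries. A point $p^\star\in\mathcal F_{\mathcal M}$ is a local minimizer of $D$ on $\mathcal F_{\mathcal M}$ if there is a relatively open set $U\subseteq\mathcal F_{\mathcal M}$ with $p^\star\in U$ and $D(p^\star)\le D(p)$ for all $p\in U$ (relative topology of $\mathcal F_{\mathcal M}$; no interiority in $\mathcal D$ is required). *)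

(* Defs.v *)
From mathcomp Require Import all_boot all_order all_algebra.
From mathcomp Require Import all_classical all_reals all_analysis.

Set Implicit Arguments.
Unset Strict Implicit.
Unset Printing Implicit Defensive.

Import Order.TTheory GRing.Theory Num.Theory.
Import numFieldNormedType.Exports.

Local Open Scope classical_set_scope.
Local Open Scope ring_scope.

Definition param_domain (R : realType) (Tmin ximax : R) : set (R * R) :=
  `[Tmin, 1]%classic `*` `[0, ximax]%classic.

Definition noise (R : realType) (eta vel T xi : R) : R :=
  1 + vel + eta * T * xi.

Definition Sigma (R : realType) (VA eta vel : R) (p : R * R) : 'M[R]_2 :=
  let: (T, xi) := p in
  let c := Num.sqrt (eta * T) * VA in
  \matrix_(i < 2, j < 2)
    nth 0 (nth [::] [:: [:: VA; c];
                        [:: c ; eta * T * VA + noise eta vel T xi]] i) j.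

(* The Kullback-Leibler divergence of the centred bivariate Gaussian laws with
   covariances S0 and S1. *)
Definition gauss_div (R : realType) (S0 S1 : 'M[R]_2) : R :=
  2^-1 * (\tr (invmx S1 *m S0) - 2 + ln (\det S1 / \det S0)).

Definition matching_set (R : realType) (M : set ('I_2 * 'I_2))
    (D : set (R * R)) (S : R * R -> 'M[R]_2) (S0 : 'M[R]_2) : set (R * R) :=
  [set p | D p /\ forall i j, M (i, j) -> S p i j = S0 i j].

(* Positions of the entries VA and sqrt(eta T) VA; the latter occupies both
   off-diagonal positions. *)
Definition trusted_correlation : set ('I_2 * 'I_2) :=
  [set (0, 0); (0, 1); (1, 0)].

Definition relatively_open (X : topologicalType) (F U : set X) : Prop :=
  exists2 O : set X, open O & U = F `&` O.

Definition local_minimizer (R : realType) (X : topologicalType) (F : set X)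
    (f : X -> R) (x : X) : Prop :=
  F x /\ exists U : set X,
    [/\ relatively_open F U, U x & forall y, U y -> f x <= f y].

(* Main.v *)
Require Import Defs.
From mathcomp Require Import all_boot all_order all_algebra.
From mathcomp Require Import all_classical all_reals all_analysis.
From mathcomp Require Import ring lra.
Import Order.TTheory GRing.Theory Num.Theory.
Import numFieldNormedType.Exports.
Local Open Scope classical_set_scope.
Local Open Scope ring_scope.

(** The entry sqrt(eta T) VA pins T = T0, so the matching set is the segment
    T = T0 in the direction of xi.  There det Sigma = VA N, and with N0 the
    benign value of N the divergence is (N0 / N - 1 + ln (N / N0)) / 2.
    This function of N is strictly monotone on each side of N0: every N <> N0
    has arbitrarily close points y towards N0 at which it is strictly smaller,
    by ln (y / N) <= y / N - 1. *)

Lemma det_mx22 (F : comPzRingType) (A : 'M[F]_2) :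
  \det A = A 0 0 * A 1 1 - A 0 1 * A 1 0.
Proof.
rewrite (expand_det_row _ 0) !big_ord_recl big_ord0 /cofactor !det_mx11 !mxE /=.
have -> : lift ord0 ord0 = 1 :> 'I_2 by apply/val_inj.
have -> : lift 1 0 = 0 :> 'I_2 by apply/val_inj.
have -> : ord0 = 0 :> 'I_2 by apply/val_inj.
rewrite /bump /=; ring.
Qed.

Lemma tr_invmx22_mul (F : fieldType) (A B : 'M[F]_2) : \det A != 0 ->
  \tr (invmx A *m B) =
    (A 1 1 * B 0 0 - A 0 1 * B 1 0 - A 1 0 * B 0 1 + A 0 0 * B 1 1) / \det A.
Proof.
move=> detA; rewrite /invmx unitmxE unitfE detA -scalemxAl mxtraceZ mulrC.
congr (_ / _); rewrite /mxtrace !big_ord_recl big_ord0 !mxE.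
rewrite !big_ord_recl !big_ord0 !mxE /cofactor.
rewrite !det_mx11 !mxE /=.
have -> : lift ord0 ord0 = 1 :> 'I_2 by apply/val_inj.
have -> : lift 1 0 = 0 :> 'I_2 by apply/val_inj.
have -> : ord0 = 0 :> 'I_2 by apply/val_inj.
rewrite /bump /=; ring.
Qed.

(** The squared correlation [eta * T * VA ^+ 2] cancels the signal part of the second variance, so
    the Schur complement of [VA] is the noise. *)
Lemma det_Sigma (R : realType) (VA eta vel T xi : R) : 0 <= eta * T ->
  \det (Sigma VA eta vel (T, xi)) = VA * noise eta vel T xi.
Proof.
move=> eT; rewrite det_mx22 !mxE /=.
transitivity (VA * (eta * T * VA + noise eta vel T xi)
  - Num.sqrt (eta * T) ^+ 2 * VA ^+ 2); first by ring.
by rewrite sqr_sqrtr//; ring.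
Qed.

(** Since both matrices share [T], the correlation terms cancel in the trace, which becomes 1 + N(a)
    / N(b). *)
Lemma gauss_div_Sigma (R : realType) (VA eta vel T a b : R) :
    0 < VA -> 0 <= eta * T -> 0 < noise eta vel T a -> 0 < noise eta vel T b ->
  gauss_div (Sigma VA eta vel (T, a)) (Sigma VA eta vel (T, b)) =
  2^-1 * (noise eta vel T a / noise eta vel T b - 1
          + ln (noise eta vel T b / noise eta vel T a)).
Proof.
move=> VA0 eT a0 b0.
rewrite /gauss_div tr_invmx22_mul ?det_Sigma ?mulf_neq0 ?gt_eqF//.
rewrite !mxE /= -mulf_div divff ?gt_eqF// mul1r; congr (_ * (_ + _)).
(* Writing [eta * T] as [s ^+ 2] leaves a rational identity in [s], within reach of [field]. *)
set s := Num.sqrt _; have ss : s ^+ 2 = eta * T by rewrite sqr_sqrtr.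
by rewrite -ss; field; rewrite !gt_eqF.
Qed.

Lemma ln_le_subr1 (R : realType) (x : R) : 0 < x -> ln x <= x - 1.
Proof. by move=> x0; rewrite lerBrDl -[leRHS]lnK// expR_ge1Dx. Qed.

(** The logarithms on the right combine to [- ln (y / x)]; the tangent bound at 1 then leaves a
    rational function that factors as the left side. This bound vanishes at [y = x0] and is positive
    for [y] strictly between [x] and [x0]; the first fact serves minimality at [x0], the second
    excludes any other [x]. *)
Lemma div_ln_decrease (R : realType) (x0 x y : R) :
    0 < x0 -> 0 < x -> 0 < y ->
  (x0 - y) * (y - x) / (x * y) <=
    (x0 / x - 1 + ln (x / x0)) - (x0 / y - 1 + ln (y / x0)).
Proof.
move=> hx0 hx hy.
have := ln_le_subr1 _ _ (divr_gt0 hy hx).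
rewrite !ln_div ?posrE// => h.
have -> : (x0 - y) * (y - x) / (x * y) = x0 / x - x0 / y - (y / x - 1).
  by field; rewrite !gt_eqF.
lra.
Qed.

Theorem proposition2 (R : realType) (VA eta vel Tmin ximax T0 xi0 : R)
    (hVA : 0 < VA) (heta0 : 0 < eta) (heta1 : eta <= 1) (hvel : 0 <= vel)
    (hTmin : 0 < Tmin) (hT0 : Tmin <= T0)
    (hp0 : param_domain Tmin ximax (T0, xi0)) :
  let S := Sigma VA eta vel in
  let S0 := S (T0, xi0) in
  let F := matching_set trusted_correlation (param_domain Tmin ximax) S S0 in
  forall p : R * R,
    local_minimizer F (fun q => gauss_div S0 (S q)) p <-> p = (T0, xi0).
Proof.
move=> S S0 F.
have T0gt0 : 0 < T0 by apply: lt_le_trans hT0.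
have eT0 : 0 < eta * T0 by rewrite mulr_gt0.
have [[T0min T01] [xi00 xi0max]] :
    (Tmin <= T0 /\ T0 <= 1) /\ (0 <= xi0 /\ xi0 <= ximax).
  by case: hp0; rewrite /= !in_itv /= => /andP[? ?] /andP[? ?].
have FE T xi : F (T, xi) <-> T = T0 /\ 0 <= xi <= ximax.
  split.
    case=> -[]; rewrite /= !in_itv /= => /andP[Tm T1] hxi.
    move=> /(_ 0 1); rewrite !mxE /= => h; split=> //.
    have {h} /(mulIf (lt0r_neq0 hVA))/eqP :
        Num.sqrt (eta * T) * VA = Num.sqrt (eta * T0) * VA.
      by apply: h; left; right.
    have Tgt0 : 0 < T by apply: lt_le_trans Tm.
    rewrite eqr_sqrt ?mulr_ge0 1?ltW// => /eqP.
    by move/(mulfI (lt0r_neq0 heta0)).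
  case=> -> hxi; split.
    by split; rewrite /= in_itv /= ?hxi ?hT0.
  by move=> i j [[|]|] [-> ->]; rewrite !mxE.
have Npos (xi : R) : 0 <= xi -> 0 < noise eta vel T0 xi.
  by move=> xi_ge0; rewrite /noise ltr_pwDl ?mulr_ge0 ?ltr_pwDl// ltW.
have Dle (a b : R) : 0 <= a -> 0 <= b ->
    2^-1 * ((noise eta vel T0 xi0 - noise eta vel T0 b) *
      (noise eta vel T0 b - noise eta vel T0 a) /
      (noise eta vel T0 a * noise eta vel T0 b)) <=
    gauss_div S0 (S (T0, a)) - gauss_div S0 (S (T0, b)).
  move=> a0 b0; have eT0W := ltW eT0.
  rewrite !gauss_div_Sigma ?Npos// -mulrBr ler_pM2l ?invr_gt0//.
  by apply: div_ln_decrease; exact: Npos.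
case=> T xi; split; last first.
  move=> ->; have F0 : F (T0, xi0) by apply/FE; rewrite xi00 xi0max.
  (* The benign point is a global minimizer, so all of [F] serves as the neighbourhood; the bound
     [Dle] vanishes at [b = xi0]. *)
  split=> //; exists F; split=> //.
    by exists setT; [exact: openT|rewrite setIT].
  move=> [T' y] /FE[-> /andP[y0 _]].
  by have := Dle _ _ y0 xi00; rewrite subrr mul0r mul0r mulr0 subr_ge0.
case=> /FE[-> /andP[xi_ge0 xi_max]] [U [[V Vopen ->] [_ Vxi] Umin]].
congr pair; apply/eqP/negPn/negP => xi_neq.
(* The path runs from [xi] straight towards [xi0]. The limit is one-sided because only 0 < t < 1
   gives points strictly between them. *)
have xi_cvg : xi + t * (xi0 - xi) @[t --> (0 : R)^'+] --> xi + 0 * (xi0 - xi).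
  apply: cvg_at_right_filter.
  by apply: cvgD; [exact: cvg_cst|apply: cvgMr_tmp; exact: cvg_id].
rewrite mul0r addr0 in xi_cvg.
have path_cvg : (T0, xi + t * (xi0 - xi)) @[t --> (0 : R)^'+] --> (T0, xi).
  exact: cvg_pair (cvg_cst T0) xi_cvg.
have Vnear := path_cvg V (open_nbhs_nbhs (conj Vopen Vxi)).
have [t [tV t0 t1]] : exists t, [/\ V (T0, xi + t * (xi0 - xi)), 0 < t & t < 1].
  apply: (@filter_ex _ (0 : R)^'+).
  near=> t; split; near: t;
    [exact: Vnear|exact: nbhs_right_gt|exact: nbhs_right_lt].
set y := xi + t * (xi0 - xi) in tV.
(* As a convex combination, [y] stays in [[0, ximax]] even when [xi] is an endpoint. *)
have yE : y = (1 - t) * xi + t * xi0 by rewrite /y; ring.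
have y0 : 0 <= y by rewrite yE addr_ge0// mulr_ge0//; lra.
have ymax : y <= ximax by rewrite yE; nra.
have yF : F (T0, y) by apply/FE; rewrite y0 ymax.
have := Umin (T0, y) (conj yF tV); rewrite leNgt => /negP; apply.
rewrite -subr_gt0; apply: lt_le_trans (Dle _ _ xi_ge0 y0).
rewrite pmulr_rgt0 ?invr_gt0// divr_gt0//; last by rewrite mulr_gt0 ?Npos.
(* The noise is affine in [xi] with slope [eta * T0], so the two differences are (1 - t) and t times
   the same nonzero quantity. *)
have -> : (noise eta vel T0 xi0 - noise eta vel T0 y) *
    (noise eta vel T0 y - noise eta vel T0 xi) =
    (eta * T0) ^+ 2 * ((1 - t) * t) * (xi - xi0) ^+ 2.
  by rewrite /noise yE; ring.
rewrite mulr_gt0//; last by rewrite exprn_even_gt0//= subr_eq0.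
by rewrite mulr_gt0 ?exprn_gt0// mulr_gt0 ?subr_gt0.
Unshelve. all: by end_near. Qed.
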